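(* Let $I=I(L_n)$ be the edge ideal of the path graph $L_n$ on $n$ vertices. For any $1\le k\le \mathrm{match}(L_n)$: (1) when $k$ is odd, $$\mathrm{v}(I^{[k]})=\begin{cases}\lfloor\frac n4\rfloor+\frac{3(k-1)}2, & \text{if } n\equiv 0,1 \pmod 4,\\ \lfloor\frac n4\rfloor+\frac{3(k-1)}2+1, & \text{if } n\equiv 2,3 \pmod 4;\end{cases}$$ (2) when $k$ is even, $$\mathrm{v}(I^{[k]})=\lfloor\tfrac n4\rfloor+\tfrac{3k}2-1.$$
   Context: For a simple graph $G$ with vertices $x_1,\dots,x_n$, its edge ideal is $I(G)=(x_ix_j : \{x_i,x_j\}\in E(G))\subseteq S=K[x_1,\dots,x_n]$, $K$ a field. $\mathrm{match}(G)$ is the maximum number of pairwise disjoint edges of $G$. For a monomial ideal $I$, the $k$-th square-free power $I^{[k]}$ is the ideal generated by all square-free monomials in $I^k$. The v-number: for a graded ideal $I$ of the standard graded polynomial ring $S$ with $\mathfrak m$ the ideal generated by all variables, $\mathrm{v}(I)=\min\{d\ge 1 : \text{there exist } f\in S_d \text{ and } \mathfrak p\in \mathrm{Ass}(I) \text{ with } (I:f)=\mathfrak p\}$ if $I\subsetneq\mathfrak m$, and $\mathrm{v}(\mathfrak m)=0$. Here $S_d$ is the degree-$d$ component and $\mathrm{Ass}(I)$ is the set of associated primes of $S/I$. *)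

(* Defs.v *)
From mathcomp Require Import all_boot all_order all_algebra.
From mathcomp Require Import boolp.
From mathcomp Require Import mpoly.

Set Implicit Arguments.
Unset Strict Implicit.
Unset Printing Implicit Defensive.

Import GRing.Theory.

(* Ideals are boolean predicates; the defining propositions are turned into
   booleans by the classical reflection `[< _ >], so that the closure
   predicates of ring_quotient apply. *)
Section Ideals.
Variable R : comNzRingType.
Implicit Types (I p : {pred R}) (G : R -> Prop).
Local Open Scope ring_scope.

Definition ideal_gen G : {pred R} :=
  [pred f | `[< exists2 s : seq (R * R),
                  (forall u, u \in s -> G u.2)
                & f = \sum_(u <- s) u.1 * u.2 >]].

Definition ideal_exp I (k : nat) : {pred R} :=
  ideal_gen (fun f => exists2 g : 'I_k -> R,
                        (forall i, g i \in I) & f = \prod_(i < k) g i).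

Definition colon I (f : R) : {pred R} := [pred g | f * g \in I].

(* idealr_closed includes 1 \notin p *)
Definition prime_ideal p : Prop := idealr_closed p /\ prime_idealr_closed p.

(* p \in Ass(R / I): p is prime and is the annihilator of the class of some g *)
Definition associated_prime I p : Prop :=
  prime_ideal p /\ exists g : R, colon I g =i p.

End Ideals.

Section PolynomialIdeals.
Variables (K : fieldType) (n : nat).
Implicit Types (I : {pred {mpoly K[n]}}) (d k : nat) (m : 'X_{1..n}).
Local Open Scope ring_scope.

Definition max_ideal : {pred {mpoly K[n]}} :=
  ideal_gen (fun f => exists i : 'I_n, f = 'X_i).

Definition squarefree_mnm m : bool := [forall i, (m i <= 1)%N].

Definition squarefree_power I k : {pred {mpoly K[n]}} :=
  ideal_gen (fun f => exists m,
    [/\ squarefree_mnm m, 'X_[m] \in ideal_exp I k & f = 'X_[m]]).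

Definition v_witness I d : Prop :=
  exists (f : {mpoly K[n]}) (p : {pred {mpoly K[n]}}),
    [/\ f \is d.-homog, associated_prime I p & colon I f =i p].

(* The v-number as a relation "v(I) = d", which asserts in particular that
   the minimum exists. *)
Definition is_v_number I d : Prop :=
  (I =i max_ideal /\ d = 0%N) \/
  [/\ {subset I <= max_ideal}, ~ (I =i max_ideal),
      (1 <= d)%N, v_witness I d
    & forall d', (1 <= d')%N -> v_witness I d' -> (d <= d')%N].

End PolynomialIdeals.

Arguments max_ideal K n : clear implicits.

Record sgraph (T : finType) := SGraph {
  adj :> rel T;
  adj_sym : ssrbool.symmetric adj;
  adj_irrefl : irreflexive adj
}.

Section Graphs.
Variable T : finType.
Implicit Types (G : sgraph T) (M : {set {set T}}).

Definition edges G : {set {set T}} :=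
  [set [set x; y] | x in T, y in T & adj G x y].

Definition is_matching G M : bool := (M \subset edges G) && trivIset M.

Definition match_number G : nat := \max_(M | is_matching G M) #|M|.

End Graphs.

Definition edge_ideal (K : fieldType) (n : nat) (G : sgraph 'I_n) :
    {pred {mpoly K[n]}} :=
  ideal_gen (fun f => exists i j : 'I_n, adj G i j /\ f = ('X_i * 'X_j)%R).

Arguments edge_ideal K [n] G.

Definition path_rel (n : nat) : rel 'I_n :=
  fun i j => (i.+1 == j :> nat) || (j.+1 == i :> nat).

Lemma path_rel_sym n : ssrbool.symmetric (@path_rel n).
Proof. by move=> i j; rewrite /path_rel orbC. Qed.

Lemma path_rel_irrefl n : irreflexive (@path_rel n).
Proof. by move=> i; rewrite /path_rel orbb gtn_eqF. Qed.

Definition path_graph (n : nat) : sgraph 'I_n :=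
  SGraph (@path_rel_sym n) (@path_rel_irrefl n).

(* Main.v *)
Require Import Defs.
From mathcomp Require Import all_boot all_order all_algebra.
From mathcomp Require Import mpoly.
From mathcomp Require Import boolp zify ring.

Set Implicit Arguments.
Unset Strict Implicit.
Unset Printing Implicit Defensive.

Import GRing.Theory.

(** A monomial lies in the [k]-th square-free power [J] of the edge ideal of the
path exactly when the subgraph induced on its support has [k] disjoint edges
([squarefree_powerP]). On a path the matching number equals the minimum weight
of a vertex cover (Koenig), and this minimum is computed by a recursion along
the path, [cover_wt]. The recursion is superadditive in the exponents, so it
bounds the powers of the edge ideal from one side; its successive differences
are the multiplicities of edges that realise the optimum, which gives the other
side.

Suppose [J : f = p] with [p] prime and [f] homogeneous. Let [m] be a monomial of
[f] outside [J], let [A] be its support, and let [C] be the set of variables in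
[p]. Then [A] has no [k] disjoint edges; [C] meets every set of [k] disjoint
edges, because [J] lies in [p]; and adding a vertex of [C] to [A] creates [k]
disjoint edges. Write [nu] for the matching number and [B] for the complement of
[C]. Two estimates hold on a path with [n] vertices.
- [n <= 2 nu(B) + 2 |C| + 1] ([match_nb_size]): deleting [C] leaves at most
  [|C| + 1] segments, each with at most one vertex unmatched.
- [|C| <= 2 (|A| - 2 nu(A))] ([count_crit]): a vertex can increase the matching
  number only next to a segment of [A] of odd length; there are [|A| - 2 nu(A)]
  such segments, with two ends each.
As [nu(A) = k - 1] and [nu(B) <= k - 1], the degree of [f], which is at least
[|A|], is at least [2k - 1 + floor((n - 2k) / 4)]. Equality is attained by one
segment of length [2k - 1] together with single vertices at distance four from
one another ([crit_word_exists]), for which the colon ideal is generated by the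
variables adjacent to odd segments. The two cases of the theorem are this single
formula, split by parity. *)

(** * Vertex covers of a weighted path *)

(** The minimum weight of a vertex cover of a path with vertex weights [w]: a
cover either contains the first vertex, or omits it and so contains the second.
With exponents as weights, it is also the largest number of edges whose product
divides the monomial. *)
Fixpoint cover_wt (w : seq nat) : nat :=
  if w is x :: w' then
    if w' is y :: w'' then minn (x + cover_wt w') (y + cover_wt w'') else 0
  else 0.

Lemma cover_wt_cons_le x w : cover_wt (x :: w) <= x + cover_wt w.
Proof. by case: w => [|y w] //=; rewrite geq_minl. Qed.

Lemma cover_wt_cons_ge x w : cover_wt w <= cover_wt (x :: w).
Proof.
case: w => [|y w] //; rewrite [leqRHS]/= leq_min leq_addl /=.
exact: cover_wt_cons_le.
Qed.

(** A cover for the weights [f + g] is a cover for [f] and for [g]. *)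
Lemma cover_wt_add (T : Type) (f g : T -> nat) r :
  cover_wt (map f r) + cover_wt (map g r) <= cover_wt [seq f i + g i | i <- r].
Proof.
(* The recursion looks two vertices ahead, hence so does the induction. *)
suff: cover_wt (map f r) + cover_wt (map g r)
         <= cover_wt [seq f i + g i | i <- r]
      /\ cover_wt (map f (behead r)) + cover_wt (map g (behead r))
         <= cover_wt [seq f i + g i | i <- behead r] by case.
elim: r => [|x [|y r] [IH1 IH2]] //.
by split; move: IH1 IH2 => /=; lia.
Qed.

Lemma cover_wt_mono (T : Type) (f g : T -> nat) r :
  (forall i, f i <= g i) -> cover_wt (map f r) <= cover_wt (map g r).
Proof.
move=> le_fg.
apply: leq_trans (leq_addr (cover_wt (map (fun i => g i - f i) r)) _) _.
apply: leq_trans (cover_wt_add _ _ _) _.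
by rewrite (@eq_map _ _ _ g) // => i; rewrite subnKC.
Qed.

(** * Matching numbers of induced subgraphs of a path *)

(** A word [s] of booleans encodes a set of vertices of the path, and
[match_nb s] is the matching number of the subgraph induced on it. *)
Definition match_nb (s : bitseq) : nat := cover_wt (map nat_of_bool s).

(** The parity of the length of the initial run of [true] in [s]. *)
Fixpoint odd_head (s : bitseq) : bool :=
  if s is b :: s' then b && ~~ odd_head s' else false.

(** A vertex put before a run of vertices completes one more edge exactly when
the run is odd. *)
Lemma match_nb_cons b s : match_nb (b :: s) = match_nb s + (b && odd_head s).
Proof.
elim: s b => [|c s IH] [] //.
  have := cover_wt_cons_ge c (map nat_of_bool s).
  have := cover_wt_cons_le c (map nat_of_bool s).
  have := IH c.
  by rewrite /match_nb /=; case: c => /=; case: (odd_head s) => /=; lia.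
have := cover_wt_cons_le c (map nat_of_bool s).
by rewrite /match_nb /=; lia.
Qed.

(** The vertices outside [s] that are adjacent to a run of odd length. The
boolean [p] stands for what precedes [s]: it is the parity of the length of the
run that ends just before [s]. *)
Fixpoint crit (p : bool) (s : bitseq) : bitseq :=
  if s is b :: s' then (~~ b && (p || odd_head s')) :: crit (b && ~~ p) s'
  else [::].

Lemma size_crit p s : size (crit p s) = size s.
Proof. by elim: s p => //= b s IH p; rewrite IH. Qed.

(** Adding a vertex joins the runs on its two sides; the matching number grows
exactly when one of them is odd. The term [p && odd_head _] is the edge that an
unmatched vertex left pending before the word would complete. *)
Lemma critP p s i : nth true s i = false ->
  let s' := set_nth true s i true in
  match_nb s' + (p && odd_head s')
  = match_nb s + (p && odd_head s) + nth false (crit p s) i.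
Proof.
elim: s p i => [|b s IH] p [|i] //=; try by rewrite nth_nil.
  move=> ->; rewrite !match_nb_cons /=.
  by case: p; case: (odd_head s) => /=; lia.
move=> /(IH (b && ~~ p)) /=; rewrite !match_nb_cons.
by move: (odd_head _) (odd_head _); case: b; case: p; case; case => /=; lia.
Qed.

(** There are [count id s - 2 * match_nb s] runs of odd length, each with at
most two neighbours outside [s]. *)
Lemma count_crit s :
  count id (crit false s) + 4 * match_nb s <= 2 * count id s.
Proof.
(* A pending vertex ([p]) weighs 2, and an odd initial run uses one unit of
   the bound for the neighbour on its left, which has already been counted. *)
suff: forall p, count id (crit p s) + 4 * (match_nb s + (p && odd_head s))
     + (p (+) odd_head s) <= 2 * count id s + 2 * p.
  by move/(_ false) => /=; lia.
elim: s => [|b s IH] p; first by case: p.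
have := IH (b && ~~ p); rewrite match_nb_cons /=.
by case: b; case: p; case: (odd_head s) => /=; lia.
Qed.

(** The [count negb s] missing vertices cut the path into at most one more
segments, and a maximum matching misses at most one vertex of each. *)
Lemma match_nb_size s : size s <= 2 * match_nb s + 2 * count negb s + 1.
Proof.
suff: forall p : bool, size s + p
    <= 2 * (match_nb s + (p && odd_head s)) + 2 * count negb s + 1
  by move/(_ false) => /=; lia.
elim: s => [|b s IH] p; first by case: p.
have := IH (b && ~~ p); rewrite match_nb_cons /=.
by case: b; case: p; case: (odd_head s) => /=; lia.
Qed.

Lemma nth_crit p s i : nth false (crit p s) i -> nth true s i = false.
Proof.
elim: s p i => [|b s IH] p [|i] //=; last exact: IH.
by case/andP=> /negbTE.
Qed.

Lemma leq_count_nth (s t : bitseq) : size s <= size t ->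
  (forall i, nth false s i -> nth false t i) -> count id s <= count id t.
Proof.
elim: s t => [|b s IH] [|c t] //= le_st sub.
apply: leq_add; last exact: IH le_st (fun i => sub i.+1).
by move: (sub 0) => /=; case: b {sub} => // ->.
Qed.

(** * The extremal problem *)

(** Here [s] is the support of a monomial outside the square-free power and [c]
is the set of variables in the colon ideal. *)
Lemma leq_count_match_nb (s c : bitseq) k :
    size c = size s -> 2 * k <= size s ->
    match_nb s < k -> match_nb (map negb c) < k ->
    (forall i, nth false c i ->
       nth true s i = false /\ k <= match_nb (set_nth true s i true)) ->
  2 * k - 1 + (size s - 2 * k) %/ 4 <= count id s.
Proof.
move=> size_c le_k nus nuc incr.
have c_crit i : nth false c i -> nth false (crit false s) i.
  case/incr=> si le_nu; have := critP false si.
  by rewrite /= !addn0; case: nth => //; lia.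
have le_c : count id c <= count id (crit false s).
  by apply: leq_count_nth; rewrite // size_c size_crit.
have := match_nb_size (map negb c); rewrite size_map count_map.
rewrite (eq_count (a2 := id)) => [|[]] //.
have [/(nthP false)[i _ ci] | no_c] := boolP (true \in c).
  have [si le_nu] := incr i ci; have := critP false si.
  by rewrite c_crit //= !addn0; have := count_crit s; lia.
(* If [c] is empty, the whole path has matching number less than [k]. *)
have: count id c = 0.
  apply/eqP; rewrite -leqn0 leqNgt -has_count.
  by apply: contra no_c => /hasP[[]].
lia.
Qed.

(** The data of an extremal word, with [odd_head] added so that the word can be
extended on the left. *)
Definition crit_word (s : bitseq) (j c : nat) : Prop :=
  [/\ match_nb s = j, match_nb (map negb (crit false s)) = j,
      count id s = c & odd_head s].

Lemma crit_word_long s j c :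
  crit_word s j c -> crit_word [:: true, true & s] j.+1 c.+2.
Proof.
case=> <- eqB <- ohs; split=> //=; rewrite ?match_nb_cons /= ?ohs //=.
  by rewrite addn0 addn1.
by rewrite eqB; case: (odd_head _) => /=; lia.
Qed.

(** The new vertex is an odd run whose right neighbour is critical, and so is
the left neighbour of [s]; the vertex between these two is left isolated. *)
Lemma crit_word_block s j c :
  crit_word s j c -> crit_word [:: true, false, false, false & s] j c.+1.
Proof.
case=> <- eqB <- ohs; split=> //=; first by rewrite !match_nb_cons /= !addn0.
by rewrite ohs !match_nb_cons /= !addn0.
Qed.

(** The word starts with up to two [false]; then come isolated [true] four apart
and a run of [2 * j + 1] [true], followed by one or two [false]. *)
Lemma crit_word_exists n j : 2 * j.+1 <= n -> exists s : bitseq,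
  [/\ size s = n, match_nb s = j, match_nb (map negb (crit false s)) = j
    & count id s = 2 * j + 1 + (n - 2 * j.+1) %/ 4].
Proof.
move=> le_jn; pose q := (n - 2 * j.+1) %/ 4.
have [t [u [le_t2 le_u1 def_n]]] :
    exists t u, [/\ t <= 2, u <= 1 & n = t + (4 * q + (2 * j + u.+2))].
  exists (minn 2 ((n - 2 * j.+1) %% 4)), ((n - 2 * j.+1) %% 4 - 2).
  by split; rewrite /q; lia.
have [s [size_s [nus nuB cnt ohs]]] : exists s,
    size s = 4 * q + (2 * j + u.+2) /\ crit_word s j (q + (2 * j + 1)).
  elim: (q) => [|q' [s [sz cw]]]; last first.
    exists [:: true, false, false, false & s].
    split; last exact: crit_word_block.
    by rewrite /= sz; lia.
  elim: (j) => [|j' [s [sz cw]]].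
    by exists (true :: nseq u.+1 false); case: (u) le_u1 => [|[|?]].
  exists [:: true, true & s]; split; first by rewrite /= sz; lia.
  by have := crit_word_long cw; rewrite !add0n !addn1 mulnS.
exists (nseq t false ++ s); split.
- by rewrite size_cat size_nseq size_s def_n.
- by elim: (t) => //= t' IH; rewrite match_nb_cons addn0.
- case: (t) le_t2 => [|[|[|//]]] _ //=; rewrite ohs !match_nb_cons.
    by rewrite /= addn0.
  by rewrite /= !addn0.
- by rewrite count_cat count_nseq cnt; rewrite /q; lia.
Qed.

(** * Ideals given by generators and their powers *)

Section IdealGen.
Variable R : comNzRingType.
Implicit Types (G : R -> Prop) (I : {pred R}).
Local Open Scope ring_scope.

Lemma ideal_genP G f :
  reflect (exists2 s : seq (R * R), (forall u, u \in s -> G u.2)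
             & f = \sum_(u <- s) u.1 * u.2) (f \in ideal_gen G).
Proof. by rewrite inE; apply: asboolP. Qed.

Lemma mem_ideal_gen G f : G f -> f \in ideal_gen G.
Proof.
move=> Gf; apply/ideal_genP; exists [:: (1, f)]; last by rewrite big_seq1 mul1r.
by move=> u; rewrite inE => /eqP->.
Qed.

Lemma ideal_gen0 G : 0 \in ideal_gen G.
Proof. by apply/ideal_genP; exists [::]; rewrite ?big_nil. Qed.

Lemma ideal_genD G f g :
  f \in ideal_gen G -> g \in ideal_gen G -> f + g \in ideal_gen G.
Proof.
move=> /ideal_genP[s Gs ->] /ideal_genP[t Gt ->]; apply/ideal_genP.
exists (s ++ t); last by rewrite big_cat.
by move=> u; rewrite mem_cat => /orP[/Gs | /Gt].
Qed.

Lemma ideal_genM G a f : f \in ideal_gen G -> a * f \in ideal_gen G.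
Proof.
move=> /ideal_genP[s Gs ->]; apply/ideal_genP.
exists [seq (a * u.1, u.2) | u <- s]; first by move=> _ /mapP[u /Gs Gu ->].
by rewrite big_map mulr_sumr; apply: eq_bigr => u _; rewrite mulrA.
Qed.

Lemma ideal_gen_ind G (P : R -> Prop) :
    P 0 -> (forall f g, P f -> P g -> P (f + g)) ->
    (forall a g, G g -> P (a * g)) ->
  forall f, f \in ideal_gen G -> P f.
Proof.
move=> P0 PD PM f /ideal_genP[s Gs ->]; rewrite big_seq.
by apply: (big_ind P) => // u /Gs; apply: PM.
Qed.

Lemma ideal_exp0 I f : f \in ideal_exp I 0.
Proof.
rewrite -[f]mulr1; apply/ideal_genM/mem_ideal_gen.
by exists (fun=> 0); [case | rewrite big_ord0].
Qed.

Lemma ideal_expS I k x f :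
  x \in I -> f \in ideal_exp I k -> x * f \in ideal_exp I k.+1.
Proof.
move=> Ix; elim/ideal_gen_ind: f / => [|f g If Ig|a _ [g Ig ->]].
- by rewrite mulr0 ideal_gen0.
- by rewrite mulrDr ideal_genD.
rewrite mulrCA; apply/ideal_genM/mem_ideal_gen.
(* The factor [x] becomes factor number 0 of the product. *)
exists (fun i => oapp g x (unlift ord0 i)).
  by move=> i; case: unliftP => [j _|_] /=.
by rewrite big_ord_recl unlift_none; under [in RHS]eq_bigr do rewrite liftK.
Qed.

Lemma ideal_exp_pred I k f : f \in ideal_exp I k.+1 -> f \in ideal_exp I k.
Proof.
elim/ideal_gen_ind: f / => [|f g|a _ [g Ig ->]].
- exact: ideal_gen0.
- exact: ideal_genD.
rewrite big_ord_recl mulrA; apply/ideal_genM/mem_ideal_gen.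
by exists (fun i => g (lift ord0 i)).
Qed.

Lemma ideal_exp_le I j k f :
  (j <= k)%N -> f \in ideal_exp I k -> f \in ideal_exp I j.
Proof.
move=> /subnKC <-; elim: (k - j)%N => [|d IH]; rewrite ?addn0 //.
by rewrite addnS => /ideal_exp_pred.
Qed.

Lemma ideal_exp_mulX I e k x f :
  x \in I -> f \in ideal_exp I k -> x ^+ e * f \in ideal_exp I (e + k).
Proof.
by move=> Ix If; elim: e => [|e IH]; rewrite ?mul1r // exprS -mulrA ideal_expS.
Qed.

End IdealGen.

(** * Ideals generated by monomials *)

Section MonomialIdeals.
Variables (K : fieldType) (n : nat).
Implicit Types (f g : {mpoly K[n]}) (m u : 'X_{1..n}).
Implicit Types (G : {mpoly K[n]} -> Prop).
Local Open Scope ring_scope.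

(** A property of monomials that passes to multiples is inherited by an ideal
from its generators. *)
Lemma msupp_ideal_gen G (Q : 'X_{1..n} -> Prop) :
    (forall g m, G g -> m \in msupp g -> Q m) ->
    (forall u m, Q m -> Q (u + m)%MM) ->
  forall f m, f \in ideal_gen G -> m \in msupp f -> Q m.
Proof.
move=> QG Qup f m If; move: f If m; apply: ideal_gen_ind.
- by move=> m; rewrite msupp0.
- by move=> f g IHf IHg m /msuppD_le; rewrite mem_cat => /orP[/IHf | /IHg].
move=> a g Gg m /msuppM_le /allpairsP[[u m'] /= [_ m'g ->]].
by apply/Qup/(QG g).
Qed.

Lemma ideal_gen_msupp G f :
    (forall m, m \in msupp f -> exists2 u, (u <= m)%MM & G 'X_[u]) ->
  f \in ideal_gen G.
Proof.
move=> Gf; rewrite [f]mpolyE big_seq.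
apply: (big_ind (fun g => g \in ideal_gen G)) => [|g h|].
- exact: ideal_gen0.
- exact: ideal_genD.
move=> m /Gf[u le_um Gu]; rewrite -(submK le_um) mpolyXD scalerAl.
exact/ideal_genM/mem_ideal_gen.
Qed.

Lemma mem_max_ideal f : (forall m, m \in msupp f -> m != 0%MM) ->
  f \in max_ideal K n.
Proof.
move=> nz_f; apply: ideal_gen_msupp => m /nz_f m_nz.
have [i mi]: exists i, (0 < m i)%N.
  apply/existsP; apply: contraR m_nz; rewrite negb_exists => /forallP m0.
  by apply/eqP/mnmP => i; rewrite mnm0E; apply/eqP; rewrite -leqn0 leqNgt.
exists U_(i)%MM; last by exists i.
by apply/mnm_lepP => j; rewrite mnm1E; case: eqP => // <-.
Qed.

End MonomialIdeals.

(** * Powers of the edge ideal of a path *)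

Section PathIdeals.
Variables (K : fieldType) (n : nat).
Implicit Types (f g : {mpoly K[n]}) (m u : 'X_{1..n}).
Local Notation I := (edge_ideal K (path_graph n)).
Local Open Scope ring_scope.

Definition exponents m : seq nat := [seq (m i : nat) | i <- enum 'I_n].
Definition supp m : bitseq := [seq (0 < m i)%N | i <- enum 'I_n].

Lemma cover_wt_edge (i j : 'I_n) :
  path_rel i j -> (0 < cover_wt (exponents (U_(i) + U_(j))))%N.
Proof.
wlog ij : i j / i.+1 = j :> nat => [hw|_].
  move=> ij; case/orP: (ij) => /eqP eqij; first exact: hw.
  by rewrite addmC; apply: hw; rewrite // path_rel_sym.
have adjacent_gt0 a (w : seq nat) : (0 < nth 0 w a)%N ->
    (0 < nth 0 w a.+1)%N -> (0 < cover_wt w)%N.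
  elim: w a => [|x w IH] [|a] //=; last first.
    move=> wa /(IH _ wa) w_gt0; exact: leq_trans (cover_wt_cons_ge x w).
  by case: w {IH} => [|y w] //= x0 y0; rewrite leq_min !addn_gt0 x0 y0.
apply: (adjacent_gt0 i); rewrite ?ij (nth_map i) ?size_enum_ord //.
  by rewrite nth_ord_enum mnmDE !mnm1E eqxx.
by rewrite nth_ord_enum mnmDE !mnm1E eqxx addn1.
Qed.

Lemma cover_wt_edge_ideal f m :
  f \in I -> m \in msupp f -> (0 < cover_wt (exponents m))%N.
Proof.
move: f m; apply: msupp_ideal_gen => [g m [i [j [ij ->]]]|u m m_gt0].
  rewrite -mpolyXD msuppX inE => /eqP ->; exact: cover_wt_edge.
apply: leq_trans m_gt0 _; apply: cover_wt_mono => i.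
by rewrite mnmDE leq_addl.
Qed.

(** Superadditivity turns a product of [k] elements into [k] units of weight. *)
Lemma cover_wt_edge_ideal_exp k f m :
  f \in ideal_exp I k -> m \in msupp f -> (k <= cover_wt (exponents m))%N.
Proof.
move: f m; apply: msupp_ideal_gen => [g m [h Ih ->]|u m le_km]; last first.
  apply: leq_trans le_km _; apply: cover_wt_mono => i.
  by rewrite mnmDE leq_addl.
elim: k h Ih m => [//|k IH] h Ih m.
rewrite big_ord_recl => /msuppM_le /allpairsP[[u m'] /= [hu hm' ->]].
have := cover_wt_add u m' (enum 'I_n).
have <- : exponents (u + m') = [seq (u i + m' i)%N | i <- enum 'I_n].
  by apply: eq_map => i; rewrite mnmDE.
apply: leq_trans; rewrite -add1n leq_add //.
  exact: cover_wt_edge_ideal (Ih ord0) hu.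
exact: IH hm'.
Qed.

Lemma sorted_enum_path : sorted (path_rel (n := n)) (enum 'I_n).
Proof.
have iota_path a l : path (fun i j => i.+1 == j) a (iota a.+1 l).
  by elim: l a => //= l IH a; rewrite eqxx IH.
have: sorted (fun i j => i.+1 == j) (map val (enum 'I_n)).
  by rewrite val_enum_ord; case: (n) => //= l; apply: iota_path.
rewrite sorted_map; apply: sub_sorted => i j /= ij.
by rewrite /path_rel ij.
Qed.

(** Give the edge from a vertex [x] to the next one the multiplicity by which
[cover_wt] drops when [x] is removed. The two edges at a vertex then use at most
its exponent, since [cover_wt (x :: y :: w) <= y + cover_wt w]. *)
Lemma monomial_ideal_exp m : 'X_[m] \in ideal_exp I (cover_wt (exponents m)).
Proof.
(* Only the part of the exponent of [x] used by its right edge is kept. *)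
suff aux x r : path (@path_rel n) x r ->
    'X_x ^+ (cover_wt [seq (m i : nat) | i <- x :: r]
             - cover_wt [seq (m i : nat) | i <- r])
      * \prod_(i <- r) 'X_i ^+ m i
    \in ideal_exp I (cover_wt [seq (m i : nat) | i <- x :: r]).
  rewrite mpolyXE_id -big_enum /exponents /=.
  have := sorted_enum_path.
  case: (enum _) => [|x r]; first by rewrite ideal_exp0.
  rewrite big_cons => /aux.
  set c := cover_wt [seq _ | _ <- _ :: _]; set c' := cover_wt [seq _ | _ <- r].
  have le_c : (c - c' <= m x)%N by rewrite leq_subLR addnC cover_wt_cons_le.
  by rewrite -(subnK le_c) exprD -mulrA => Ic; apply: ideal_genM.
elim: r x => [|y r IH] x; first by rewrite ideal_exp0.
case/andP=> xy /IH.
set w0 := cover_wt [seq _ | _ <- r].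
set w1 := cover_wt [seq _ | _ <- y :: r].
set w2 := cover_wt [seq _ | _ <- x :: y :: r] => Iw1.
have le12 : (w1 <= w2)%N by apply: cover_wt_cons_ge.
have le01 : (w0 <= w1)%N by apply: cover_wt_cons_ge.
have le20 : (w2 <= m y + w0)%N by apply: geq_minr.
rewrite big_cons.
have -> : m y = (w2 - w1 + (m y - (w2 - w0)) + (w1 - w0))%N by lia.
rewrite !exprD.
have -> (a b c d e : {mpoly K[n]}) :
    a * (b * c * d * e) = c * ((a * b) * (d * e)).
  by ring.
apply: ideal_genM; rewrite -exprMn.
have Ixy : 'X_x * 'X_y \in I by apply: mem_ideal_gen; exists x, y.
by have := ideal_exp_mulX (w2 - w1) Ixy Iw1; rewrite subnK.
Qed.

Lemma match_nb_supp_mono m m' : (forall i, 0 < m i -> 0 < m' i)%N ->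
  (match_nb (supp m) <= match_nb (supp m'))%N.
Proof.
move=> le_m; rewrite /match_nb -!map_comp; apply: cover_wt_mono => i /=.
by have := le_m i; case: ltnP => // _ ->.
Qed.

Lemma supp_squarefree m : squarefree_mnm m ->
  match_nb (supp m) = cover_wt (exponents m).
Proof.
move=> /forallP sq; rewrite /match_nb -map_comp; congr cover_wt.
by apply: eq_map => i /=; have := sq i; case: (m i) => [|[]].
Qed.

Definition radical_mnm m : 'X_{1..n} :=
  [multinom nat_of_bool (0 < m i)%N | i < n].

(** A square-free power is a radical monomial ideal: only supports matter. *)
Lemma squarefree_powerP k f :
  f \in squarefree_power I k
  <-> (forall m, m \in msupp f -> (k <= match_nb (supp m))%N).
Proof.
split=> [If m|supp_f].
  move: If; move: f m; apply: msupp_ideal_gen; last first.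
    move=> u m le_k; apply: leq_trans le_k _; apply: match_nb_supp_mono => i.
    by rewrite mnmDE addn_gt0 orbC => ->.
  move=> _ m [u [sq Iu ->]]; rewrite msuppX inE => /eqP ->.
  by rewrite supp_squarefree // (cover_wt_edge_ideal_exp Iu) // msuppX inE.
apply: ideal_gen_msupp => m /supp_f le_k; exists (radical_mnm m).
  by apply/mnm_lepP => i; rewrite mnmE; case: (m i).
have sq : squarefree_mnm (radical_mnm m).
  by apply/forallP => i; rewrite mnmE leq_b1.
exists (radical_mnm m); split=> //.
apply: ideal_exp_le (monomial_ideal_exp _).
rewrite -supp_squarefree // (_ : supp _ = supp m) //.
by apply: eq_map => i; rewrite mnmE; case: (m i).
Qed.

End PathIdeals.

(** The edges of a matching cover twice as many vertices. *)
Lemma match_number_path n : 2 * match_number (path_graph n) <= n.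
Proof.
suff: match_number (path_graph n) <= n./2 by lia.
apply/bigmax_leqP => M /andP[/subsetP Msub /eqP tri].
have: #|cover M| <= n by rewrite -[leqRHS]card_ord max_card.
rewrite -tri (eq_bigr (fun=> 2)) ?sum_nat_const; first by lia.
move=> e /Msub /imset2P[x y _]; rewrite inE => /andP[_ xy] ->.
by rewrite cards2; case: eqP xy => // ->; rewrite (adj_irrefl (path_graph n)).
Qed.

(** * Prime ideals generated by variables *)

Section VariableIdeals.
Variables (K : fieldType) (n : nat) (C : pred 'I_n).
Implicit Types (f g : {mpoly K[n]}) (m : 'X_{1..n}).
Local Open Scope ring_scope.

Definition meets m : bool := [exists i, C i && (0 < m i)%N].

(* The kernel of this substitution is the ideal generated by the variables
   in [C]. *)
Let kill : n.-tuple {mpoly K[n]} := [tuple if C i then 0 else 'X_i | i < n].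

Lemma killX m : 'X_[m] \mPo kill = if meets m then 0 else 'X_[m].
Proof.
rewrite comp_mpolyX; case: ifPn => [/existsP[i /andP[Ci mi]]|].
  by rewrite (bigD1 i) //= tnth_mktuple Ci expr0n (gtn_eqF mi) mul0r.
rewrite negb_exists => /forallP nomeet; rewrite [RHS]mpolyXE_id.
apply: eq_bigr => i _; rewrite tnth_mktuple; case: ifP => // Ci.
by have := nomeet i; rewrite Ci lt0n negbK => /eqP ->; rewrite !expr0.
Qed.

Lemma kill_eq0 f : (f \mPo kill == 0) = all meets (msupp f).
Proof.
rewrite comp_mpolyEX; apply/eqP/allP => [kf0 m|f_meets]; last first.
  by rewrite big_seq big1 // => m /f_meets mm; rewrite killX mm scaler0.
rewrite mcoeff_msupp; apply: contraR => nomeet.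
have := congr1 (mcoeff m) kf0; rewrite mcoeff0 => <-.
rewrite [f in f@_m]mpolyE !raddf_sum /=; apply/eqP/eq_bigr => u _.
rewrite killX !mcoeffZ mcoeffX; case: ifP => [mu|_]; last by rewrite mcoeffX.
by case: eqP mu => [->|_ _]; rewrite ?(negbTE nomeet) // mcoeff0.
Qed.

(** Such a [p] is the kernel of a ring morphism into an integral domain. *)
Lemma prime_ideal_meets p :
  (forall f, (f \in p) = all meets (msupp f)) -> prime_ideal p.
Proof.
move=> def_p; have {}def_p f : (f \in p) = (f \mPo kill == 0).
  by rewrite kill_eq0.
split=> [|f g]; last by rewrite !def_p rmorphM mulf_eq0.
split=> [||a f g]; rewrite !def_p ?rmorph0 ?rmorph1 ?oner_eq0 //.
by move=> /eqP f0 /eqP g0; rewrite rmorphD rmorphM /= f0 g0 mulr0 addr0.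
Qed.

End VariableIdeals.

(** * The v-number *)

Section VNumber.
Variables (K : fieldType) (n : nat).
Implicit Types (f g : {mpoly K[n]}) (m u : 'X_{1..n}).
Local Notation J k := (squarefree_power (edge_ideal K (path_graph n)) k).
Local Open Scope ring_scope.

Lemma size_supp m : size (supp m) = n.
Proof. by rewrite size_map size_enum_ord. Qed.

Lemma nth_supp b m (i : 'I_n) : nth b (supp m) i = (0 < m i)%N.
Proof. by rewrite (nth_map i) ?size_enum_ord // nth_ord_enum. Qed.

Lemma supp_addU m (i : 'I_n) : supp (m + U_(i)) = set_nth true (supp m) i true.
Proof.
apply: (@eq_from_nth _ true) => [|j].
  by rewrite size_set_nth !size_supp; apply/esym/maxn_idPr.
rewrite size_supp => lt_j.
rewrite -[j]/(nat_of_ord (Ordinal lt_j)); move: (Ordinal _) => {lt_j}j.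
rewrite nth_set_nth /= !nth_supp mnmDE mnm1E addn_gt0 lt0b orbC -val_eqE /=.
by rewrite eq_sym; case: eqP.
Qed.

Lemma count_supp m : (count id (supp m) <= mdeg m)%N.
Proof.
rewrite count_map -sum1_count big_mkcond big_enum mdegE /=.
by apply: leq_sum => i _; case: (m i).
Qed.

Definition word_mnm (s : bitseq) : 'X_{1..n} :=
  [multinom nat_of_bool (nth false s i) | i < n].

Lemma supp_word_mnm s : size s = n -> supp (word_mnm s) = s.
Proof.
move=> size_s.
apply: (@eq_from_nth _ true) => [|j]; rewrite size_supp // => lt_j.
rewrite -[j]/(val (Ordinal lt_j)) nth_supp mnmE lt0b.
by apply: set_nth_default; rewrite size_s.
Qed.

Lemma mdeg_word_mnm s : size s = n -> mdeg (word_mnm s) = count id s.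
Proof.
move=> size_s; rewrite -{2}(supp_word_mnm size_s) count_map -sum1_count.
rewrite big_mkcond big_enum mdegE /=.
by apply: eq_bigr => i _; rewrite mnmE; case: nth.
Qed.

Lemma prime_ideal_mnm (p : {pred {mpoly K[n]}}) m : prime_ideal p ->
  'X_[m] \in p -> exists2 i : 'I_n, (0 < m i)%N & 'X_i \in p.
Proof.
case=> [[_ p1 _] pr_p]; rewrite mpolyXE_id.
suff: forall r : seq 'I_n, \prod_(i <- r) 'X_i ^+ m i \in p ->
   exists2 i : 'I_n, (0 < m i)%N & 'X_i \in p by apply.
elim=> [|i r IH]; first by rewrite big_nil (negbTE p1).
rewrite big_cons => /pr_p/orP[|/IH //].
case mi : (m i) => [|e]; first by rewrite expr0 (negbTE p1).
move=> pXe; exists i; rewrite ?mi //; elim: e pXe {mi} => [|e IHe] //.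
by rewrite exprS => /pr_p/orP[] // /IHe.
Qed.

(** The monomial [m] of [f] and the set [c] of variables in the prime ideal
satisfy the hypotheses of [leq_count_match_nb]. *)
Lemma v_witness_ge k d : (2 * k <= n)%N -> v_witness (J k) d ->
  (2 * k - 1 + (n - 2 * k) %/ 4 <= d)%N.
Proof.
move=> le_k [f [p [/dhomogP hom_f [pr_p _] colon_p]]].
have [[_ p1 _] _] := pr_p.
have inp g : (g \in p) = (f * g \in J k) by rewrite -colon_p inE.
have [m mf nu_m] : exists2 m, m \in msupp f & (match_nb (supp m) < k)%N.
  apply/hasP; apply: contraNT p1 => /hasPn nof.
  rewrite inp mulr1; apply/squarefree_powerP => m /nof.
  by rewrite -leqNgt.
rewrite -(hom_f m mf); apply: leq_trans (count_supp m).
pose c : bitseq := [seq 'X_i \in p | i <- enum 'I_n].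
have size_c : size c = n by rewrite size_map size_enum_ord.
have nthc b (i : 'I_n) : nth b c i = ('X_i \in p).
  by rewrite (nth_map i) ?size_enum_ord // nth_ord_enum.
(* Multiplying [f] by a variable of [p] puts all its monomials into the ideal,
   and the ideal itself lies in [p]. *)
have := @leq_count_match_nb (supp m) c k; rewrite size_supp; apply=> //.
  rewrite ltnNge; apply/negP => le_nu.
  have size_nc : size (map negb c) = n by rewrite size_map.
  have: 'X_[word_mnm (map negb c)] \in p.
    rewrite inp; apply/ideal_genM/squarefree_powerP => u.
    by rewrite msuppX inE => /eqP ->; rewrite supp_word_mnm.
  case/(prime_ideal_mnm pr_p) => i; rewrite mnmE lt0b.
  by rewrite (nth_map true) ?size_c // nthc => /negP.
move=> i0 ci0; have lt_i : (i0 < n)%N.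
  by rewrite -size_c ltnNge; apply: contraL ci0 => /(nth_default false) ->.
move: ci0; rewrite -[i0]/(val (Ordinal lt_i)) nthc nth_supp -supp_addU.
move: (Ordinal lt_i) => i; rewrite inp => /squarefree_powerP supp_fX.
have {supp_fX} le_k' : (k <= match_nb (supp (m + U_(i))))%N.
  by apply: supp_fX; rewrite (perm_mem (msuppMX _ _)) addmC map_f.
split=> //; apply/negP => mi; move: nu_m; rewrite ltnNge => /negP; apply.
apply: leq_trans le_k' _; apply: match_nb_supp_mono => l.
by rewrite mnmDE mnm1E addn_gt0 lt0b => /orP[|/eqP <-].
Qed.

(** The colon ideal of the monomial of an extremal word [s] is generated by the
critical variables of [s]: adding one of them raises the matching number to [k],
while the complement of all of them still has matching number [k - 1]. *)
Lemma v_witness_word k : (0 < k)%N -> (2 * k <= n)%N ->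
  v_witness (J k) (2 * k - 1 + (n - 2 * k) %/ 4).
Proof.
case: k => // j _ le_j.
have [s [size_s nus nuB cnt]] := crit_word_exists le_j.
pose u := word_mnm s; pose C (i : 'I_n) := nth false (crit false s) i.
have size_B : size (map negb (crit false s)) = n by rewrite size_map size_crit.
have colonE g : (g \in colon (J j.+1) 'X_[u]) = all (meets C) (msupp g).
  rewrite inE mulrC; apply/idP/allP => [/squarefree_powerP supp_g m mg|g_meets].
    have : (j < match_nb (supp (u + m)))%N.
      by apply: supp_g; rewrite (perm_mem (msuppMX _ _)) map_f.
    apply: contraLR => nomeet; rewrite -leqNgt -nuB -(supp_word_mnm size_B).
    apply: match_nb_supp_mono => l; rewrite mnmDE addn_gt0 !mnmE !lt0b.
    rewrite (nth_map true) ?size_crit ?size_s // => sml.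
    apply/negP => cl; have Cl : C l.
      by rewrite /C (set_nth_default true) ?size_crit ?size_s.
    case/orP: sml => [sl|ml].
      by move: sl; rewrite (set_nth_default true) ?size_s // (nth_crit Cl).
    by case/existsP: nomeet; exists l; rewrite Cl.
  apply/squarefree_powerP => m.
  rewrite (perm_mem (msuppMX _ _)) => /mapP[v /g_meets/existsP[i]].
  move=> /andP[Ci vi] ->.
  have := critP false (nth_crit Ci).
  rewrite [nth _ _ _]Ci /= !addn0 nus addn1.
  rewrite -{1}(supp_word_mnm size_s) -supp_addU => <-.
  apply: match_nb_supp_mono => l; rewrite !mnmDE mnm1E !addn_gt0 lt0b.
  by case/orP=> [-> // | /eqP <-]; rewrite vi orbT.
exists 'X_[u], (colon (J j.+1) 'X_[u]); split=> //.
  by rewrite dhomogX /= mdeg_word_mnm // cnt; lia.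
split; last by exists 'X_[u].
exact: prime_ideal_meets colonE.
Qed.

End VNumber.

Lemma leq_match_nb_mdeg n (m : 'X_{1..n}) :
  2 * match_nb (supp m) <= mdeg m.
Proof. by have := count_crit (supp m); have := count_supp m; lia. Qed.

Lemma is_v_number_path (K : fieldType) n k : 0 < k -> 2 * k <= n ->
  is_v_number (squarefree_power (edge_ideal K (path_graph n)) k)
    (2 * k - 1 + (n - 2 * k) %/ 4).
Proof.
move=> k_gt0 le_k; right; split.
- move=> f /squarefree_powerP nu_f; apply: mem_max_ideal => m /nu_f le_nu.
  apply: contraTneq le_nu => ->; rewrite -ltnNge.
  by have := leq_match_nb_mdeg (0%MM : 'X_{1..n}); rewrite mdeg0; lia.
- have n_gt0 : 0 < n by lia.
  pose i := Ordinal n_gt0.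
  have max_Xi : ('X_i)%R \in max_ideal K n by apply: mem_ideal_gen; exists i.
  move=> /(_ ('X_i)%R); rewrite max_Xi.
  move/squarefree_powerP => /(_ U_(i)%MM); rewrite msuppX inE eqxx => /(_ isT).
  by have := leq_match_nb_mdeg U_(i)%MM; rewrite mdeg1; lia.
- by lia.
- exact: v_witness_word.
- by move=> d _; apply: v_witness_ge.
Qed.

Theorem theorem5p11 (K : fieldType) (n k : nat)
    (hk : 1 <= k <= match_number (path_graph n)) :
  (odd k ->
     is_v_number (squarefree_power (edge_ideal K (path_graph n)) k)
       (if n %% 4 \in [:: 0; 1]
        then n %/ 4 + (3 * (k - 1)) %/ 2
        else n %/ 4 + (3 * (k - 1)) %/ 2 + 1)) /\
  (~~ odd k ->
     is_v_number (squarefree_power (edge_ideal K (path_graph n)) k)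
       (n %/ 4 + (3 * k) %/ 2 - 1)).
Proof.
case/andP: hk => k_gt0 le_k.
have le_2k : 2 * k <= n.
  by apply: leq_trans (match_number_path n); rewrite leq_mul2l.
have vJ := is_v_number_path K k_gt0 le_2k.
rewrite !inE; set v := 2 * k - 1 + _ in vJ; split=> odd_k.
  case: ifP => n4; first by have -> : n %/ 4 + (3 * (k - 1)) %/ 2 = v by lia.
  by have -> : n %/ 4 + (3 * (k - 1)) %/ 2 + 1 = v by lia.
by have -> : n %/ 4 + (3 * k) %/ 2 - 1 = v by lia.
Qed.
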